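(* Let $X=(X,\|\cdot\|)$ be a real normed linear space. If $p\geq 1$, then for all nonzero $x,y\in X$, $$\|x\|^{p}+\|y\|^{p}-\left(\|x\|+\|y\|-\|x-y\|\right)\left(\max\{\|x\|,\|y\|\}\right)^{p-1}\leq \alpha_p[x,y]\leq \|x\|^{p}+\|y\|^{p}-\left(\|x\|+\|y\|-\|x-y\|\right)\left(\min\{\|x\|,\|y\|\}\right)^{p-1}.$$ If $p<1$ ($p\in\mathbb{R}$), then both inequalities are reversed, i.e. for all nonzero $x,y\in X$, $$\|x\|^{p}+\|y\|^{p}-\left(\|x\|+\|y\|-\|x-y\|\right)\left(\min\{\|x\|,\|y\|\}\right)^{p-1}\leq \alpha_p[x,y]\leq \|x\|^{p}+\|y\|^{p}-\left(\|x\|+\|y\|-\|x-y\|\right)\left(\max\{\|x\|,\|y\|\}\right)^{p-1}.$$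
   Context: For $p\in\mathbb{R}$ and nonzero vectors $x,y$ of a real normed linear space, the $p$-angular distance is $\alpha_p[x,y]=\big\|\,\|x\|^{p-1}x-\|y\|^{p-1}y\,\big\|$. *)

(* Defs.v *)
From mathcomp Require Import all_boot all_order all_algebra.
From mathcomp Require Import all_classical all_reals all_analysis.
Import Order.TTheory GRing.Theory Num.Theory.
Import numFieldNormedType.Exports.

Set Implicit Arguments.
Unset Strict Implicit.
Unset Printing Implicit Defensive.

Local Open Scope ring_scope.

(* Meaningful for nonzero x and y only: at a zero vector the exponential
   carries the conventions 0 `^ 0 = 1 and 0 `^ s = 0 for s != 0. *)
Definition p_angular_dist (R : realType) (X : normedModType R) (p : R)
    (x y : X) : R :=
  `| (`|x| `^ (p - 1)) *: x - (`|y| `^ (p - 1)) *: y |.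

(* Main.v *)
Require Import Defs.
From mathcomp Require Import all_boot all_order all_algebra.
From mathcomp Require Import all_classical all_reals all_analysis.
From mathcomp Require Import lra.
Import Order.TTheory GRing.Theory Num.Theory.
Import numFieldNormedType.Exports.

Local Open Scope ring_scope.

(** Both bounds are instances of one fact about arbitrary nonnegative weights
[a], [b].  If [a <= b], write [a *: x - b *: y] in two ways:
[a *: (x - y) - (b - a) *: y] and [b *: (x - y) - (b - a) *: x].  The triangle
inequality applied to the first gives the upper bound, the reverse triangle
inequality applied to the second gives the lower bound, and both bounds take
the common form
  [a * `|x| + b * `|y| - (`|x| + `|y| - `|x - y|) * c]
with [c] the smaller weight for the upper one and the larger weight for the
lower one ([norm_weightedB_bounds]).

The theorem follows by taking [a = `|x| `^ (p - 1)] and [b = `|y| `^ (p - 1)].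
The power function with exponent [p - 1] is nondecreasing on the positive
reals when [1 <= p] and nonincreasing when [p < 1].  In the first case it
commutes with the maximum and the minimum ([powR_maxmin_ge0]); in the second it
exchanges them ([powR_maxmin_le0]),
which is why the inequalities are reversed. *)

Lemma norm_weightedB_bounds_ordered (R : realType) (X : normedModType R)
    (a b : R) (x y : X) : 0 <= a -> a <= b ->
  a * `|x| + b * `|y| - (`|x| + `|y| - `|x - y|) * b <= `|a *: x - b *: y|
    <= a * `|x| + b * `|y| - (`|x| + `|y| - `|x - y|) * a.
Proof.
move=> a0 ab; have b0 := le_trans a0 ab.
have ba0 : 0 <= b - a by rewrite subr_ge0.
have Ey : a *: x - b *: y = a *: (x - y) - (b - a) *: y.
  by rewrite scalerBr scalerBl opprB addrA subrK.
have Ex : a *: x - b *: y = b *: (x - y) - (b - a) *: x.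
  by rewrite scalerBr scalerBl opprB [RHS]addrC addrA subrK.
apply/andP; split.
- have := lerB_dist (b *: (x - y)) ((b - a) *: x).
  rewrite -Ex !normrZ (ger0_norm b0) (ger0_norm ba0) => h; lra.
- have := ler_normB (a *: (x - y)) ((b - a) *: y).
  rewrite -Ey !normrZ (ger0_norm a0) (ger0_norm ba0) => h; lra.
Qed.

(** The estimate is symmetric under exchanging [(a, x)] and [(b, y)], so the
order of the two weights does not matter. *)
Lemma norm_weightedB_bounds (R : realType) (X : normedModType R)
    (a b : R) (x y : X) : 0 <= a -> 0 <= b ->
  a * `|x| + b * `|y| - (`|x| + `|y| - `|x - y|) * Num.max a b
    <= `|a *: x - b *: y|
    <= a * `|x| + b * `|y| - (`|x| + `|y| - `|x - y|) * Num.min a b.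
Proof.
move=> a0 b0; case: (leP a b) => [ab|/ltW ba].
  exact: norm_weightedB_bounds_ordered.
rewrite (distrC x y) (distrC (a *: x)) (addrC (a * _)) (addrC `|x|).
exact: norm_weightedB_bounds_ordered.
Qed.

Lemma powR_le0_homo (R : realType) (r a b : R) :
  r <= 0 -> 0 < a -> a <= b -> b `^ r <= a `^ r.
Proof.
move=> r0 a0 ab; have b0 := lt_le_trans a0 ab.
rewrite -[r]opprK (powRN b) (powRN a) lef_pV2 ?posrE ?powR_gt0//.
apply: ge0_ler_powR; rewrite ?oppr_ge0 ?nnegrE //; exact: ltW.
Qed.

Lemma powR_maxmin_ge0 (R : realType) (r a b : R) :
  0 <= r -> 0 <= a -> 0 <= b ->
  (Num.max a b `^ r = Num.max (a `^ r) (b `^ r)) *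
  (Num.min a b `^ r = Num.min (a `^ r) (b `^ r)).
Proof.
move=> r0 a0 b0; case: (leP a b) => [ab|/ltW ba].
  have h : a `^ r <= b `^ r by apply: ge0_ler_powR.
  by rewrite max_r ?min_l.
have h : b `^ r <= a `^ r by apply: ge0_ler_powR.
by rewrite max_l ?min_r.
Qed.

Lemma powR_maxmin_le0 (R : realType) (r a b : R) :
  r <= 0 -> 0 < a -> 0 < b ->
  (Num.max a b `^ r = Num.min (a `^ r) (b `^ r)) *
  (Num.min a b `^ r = Num.max (a `^ r) (b `^ r)).
Proof.
move=> r0 a0 b0; case: (leP a b) => [ab|/ltW ba].
  have h := powR_le0_homo _ r a b r0 a0 ab.
  by rewrite max_l ?min_r.
have h := powR_le0_homo _ r b a r0 b0 ba.
by rewrite max_r ?min_l.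
Qed.

Lemma powR_predM (R : realType) (p a : R) : a != 0 -> 0 <= a ->
  a `^ (p - 1) * a = a `^ p.
Proof.
move=> an0 a0; rewrite -[X in _ * X](powRr1 a0) -powRD ?subrK//.
by rewrite an0 implybT.
Qed.

Lemma p_angular_dist_bounds (R : realType) (X : normedModType R) (p : R)
    (x y : X) : x != 0 -> y != 0 ->
  `|x| `^ p + `|y| `^ p
    - (`|x| + `|y| - `|x - y|) * Num.max (`|x| `^ (p - 1)) (`|y| `^ (p - 1))
    <= p_angular_dist p x y
    <= `|x| `^ p + `|y| `^ p
    - (`|x| + `|y| - `|x - y|) * Num.min (`|x| `^ (p - 1)) (`|y| `^ (p - 1)).
Proof.
move=> x0 y0.
rewrite -(powR_predM _ p `|x|) ?normr_eq0// -(powR_predM _ p `|y|) ?normr_eq0//.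
by apply: norm_weightedB_bounds; exact: powR_ge0.
Qed.

Theorem corollary2 (R : realType) (X : normedModType R) (p : R) :
  (1 <= p -> forall x y : X, x != 0 -> y != 0 ->
     `|x| `^ p + `|y| `^ p
       - (`|x| + `|y| - `|x - y|) * (Num.max `|x| `|y|) `^ (p - 1)
     <= p_angular_dist p x y
   /\
     p_angular_dist p x y
     <= `|x| `^ p + `|y| `^ p
       - (`|x| + `|y| - `|x - y|) * (Num.min `|x| `|y|) `^ (p - 1))
  /\
  (p < 1 -> forall x y : X, x != 0 -> y != 0 ->
     `|x| `^ p + `|y| `^ p
       - (`|x| + `|y| - `|x - y|) * (Num.min `|x| `|y|) `^ (p - 1)
     <= p_angular_dist p x y
   /\
     p_angular_dist p x y
     <= `|x| `^ p + `|y| `^ p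
       - (`|x| + `|y| - `|x - y|) * (Num.max `|x| `|y|) `^ (p - 1)).
Proof.
split=> hp x y x0 y0; apply/andP.
- rewrite !powR_maxmin_ge0 ?subr_ge0//.
  exact: p_angular_dist_bounds.
- rewrite !powR_maxmin_le0 ?normr_gt0 ?subr_le0 ?(ltW hp)//.
  exact: p_angular_dist_bounds.
Qed.
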